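(* Let $A \in L(H)$ and $\rho > 0$ with $\sigma(A) \cap S_\rho = \emptyset$, let $M_\rho \coloneqq \sup_{z \in S_\rho} |(z-A)^{-1}|_{L(H)}$, and let $F \colon \ell_{2,\rho}(\mathbb{Z}; H) \to \ell_{2,\rho}(\mathbb{Z}; H)$ have Lipschitz constant $|F|_{\operatorname{Lip}(\ell_{2,\rho}(\mathbb{Z}; H))} < 1/M_\rho$. Then the Lyapunov--Perron operator $$\mathcal{L}_\rho \colon H \times \ell_{2,\rho}(\mathbb{Z}; H) \to \ell_{2,\rho}(\mathbb{Z}; H),\qquad (x,u) \mapsto \chi_{\mathbb{Z}_{\geq 0}} (\tau - A)^{-1}(F(u) + \delta_{-1} x),$$ is well-defined, and for every $x \in H$ the map $\mathcal{L}_\rho(x, \cdot)$ is a contraction on $\ell_{2,\rho}(\mathbb{Z}; H)$.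
   Context: $H$ is a separable complex Hilbert space, $\sigma(A)$ the spectrum of $A$, $S_\rho=\{|z|=\rho\}$. $\ell_{2,\rho}(\mathbb{Z}; H) = \{u \in H^{\mathbb{Z}} : \sum_{k} |u_k|_H^2 \rho^{-2k} < \infty\}$. $\tau$ is the shift $(\tau u)_n = u_{n+1}$, $A$ acts componentwise $(Au)_n = Au_n$, $(\tau-A)^{-1}$ is the inverse of $\tau-A$ on $\ell_{2,\rho}(\mathbb{Z};H)$, $\delta_{-1}x$ is the sequence with entry $x$ at index $-1$ and $0$ elsewhere, and $\chi_{\mathbb{Z}_{\geq 0}}$ denotes multiplication by the indicator of $\mathbb{Z}_{\geq 0}$, i.e. $(\chi_{\mathbb{Z}_{\geq0}}v)_n = v_n$ for $n\ge0$ and $0$ for $n<0$. *)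

(* Defs.v *)
From HB Require Import structures.
From mathcomp Require Import all_boot all_order all_algebra.
From mathcomp Require Import all_classical all_reals.
From mathcomp Require Import ereal topology normedtype sequences esum.
From mathcomp Require Import complex.

Set Implicit Arguments.
Unset Strict Implicit.
Unset Printing Implicit Defensive.

Import Order.TTheory GRing.Theory Num.Theory.
Local Open Scope classical_set_scope.
Local Open Scope ring_scope.

Section Hilbert.
Variables (R : realType) (H : lmodType R[i]) (ip : H -> H -> R[i]).

Definition hnorm (x : H) : R := Num.sqrt (complex.Re (ip x x)).

Definition is_hilbert : Prop :=
  [/\ (forall (a : R[i]) x y z, ip (a *: x + y) z = a * ip x z + ip y z)
      /\ (forall x y, ip y x = conjc (ip x y)),
      (forall x, 0 <= ip x x),
      (forall x, ip x x = 0 -> x = 0),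
      (forall u : nat -> H,
          (forall e : R, 0 < e -> exists N : nat, forall m n : nat,
              (N <= m)%N -> (N <= n)%N -> hnorm (u m - u n) < e) ->
          exists l : H, forall e : R, 0 < e -> exists N : nat, forall n : nat,
              (N <= n)%N -> hnorm (u n - l) < e) &
      (exists d : nat -> H, forall (x : H) (e : R), 0 < e ->
          exists n : nat, hnorm (x - d n) < e)].

Definition bounded_op (B : H -> H) : Prop :=
  exists c : R, forall x, hnorm (B x) <= c * hnorm x.

Definition opnorm (B : H -> H) : R :=
  sup [set hnorm (B x) | x in [set x : H | hnorm x <= 1]].

Definition is_resolvent (A : H -> H) (z : R[i]) (B : {linear H -> H}) : Prop :=
  bounded_op B /\
  (forall x, B (z *: x - A x) = x) /\ (forall y, z *: B y - A (B y) = y).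

Definition in_spectrum (A : H -> H) (z : R[i]) : Prop :=
  ~ exists B : {linear H -> H}, is_resolvent A z B.

Definition M_rho (A : H -> H) (rho : R) : R :=
  sup [set r : R | exists z : R[i], `|z| = (rho%:C)%C /\
         exists B : {linear H -> H}, is_resolvent A z B /\ r = opnorm B].

Definition l2w_sq (rho : R) (u : int -> H) : \bar R :=
  (\esum_(k in [set: int]) ((hnorm (u k)) ^+ 2 * rho ^ (-2 * k))%:E)%E.

Definition in_l2w (rho : R) (u : int -> H) : Prop := (l2w_sq rho u < +oo)%E.

Definition normw (rho : R) (u : int -> H) : R := Num.sqrt (fine (l2w_sq rho u)).

End Hilbert.

Section Seq.
Variables (R : realType) (H : lmodType R[i]).

Definition tau (u : int -> H) : int -> H := fun n => u (n + 1).
Definition compw (A : H -> H) (u : int -> H) : int -> H := fun n => A (u n).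
Definition delta_m1 (x : H) : int -> H := fun n => if n == -1 then x else 0.
Definition chi_nonneg (v : int -> H) : int -> H := fun n => if 0 <= n then v n else 0.
Definition zadd (u v : int -> H) : int -> H := fun n => u n + v n.
Definition zsub (u v : int -> H) : int -> H := fun n => u n - v n.

End Seq.

(* Main.v *)
Require Import Defs.
From HB Require Import structures.
From mathcomp Require Import all_boot all_order all_algebra.
From mathcomp Require Import cyclic separable cyclotomic.
From mathcomp Require Import all_classical all_reals.
From mathcomp Require Import ereal topology normedtype sequences esum.
From mathcomp Require Import complex.
From mathcomp Require Import ring lra zify.
Set Implicit Arguments.
Unset Strict Implicit.
Unset Printing Implicit Defensive.
Import Order.TTheory GRing.Theory Num.Theory.
Import numFieldNormedType.Exports.
Local Open Scope classical_set_scope.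
Local Open Scope ring_scope.

(** With [U k = rho^-k u k], the equation [(tau - A) u = v] becomes
    [rho U (k+1) - A (U k) = V k] in the unweighted l2.  For N-periodic
    sequences the discrete Fourier transform over the N-th roots of unity s
    turns it into [(rho s - A) \hat U = \hat V], so Plancherel gives
    [|U| <= M_rho |V|], and the inverse transform solves the equation.  An l2
    sequence has arbitrarily small entries, at which it can be cut to a finite
    window and closed up to a periodic one at negligible cost: hence
    [|U| <= M_rho |V|] on all of l2.  Conversely a periodic solution cut at one
    of its small entries almost solves the equation on Z, so the range is
    dense, and by the a priori bound and completeness it is everything.
    Thus [(tau - A)^-1] has norm at most [M_rho], and the contraction constant
    is [Lip F * M_rho]. *)

(** * Roots of unity and an averaging principle *)

(** ['X^n - 1] splits and, in characteristic 0, is separable, so it has [n] distinct roots; a group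
    of [n] distinct [n]-th roots of unity is cyclic. *)
Lemma prim_root_exists (C : numClosedFieldType) (n : nat) :
  (0 < n)%N -> exists z : C, n.-primitive_root z.
Proof.
move=> n0; have [r Dp] := closed_field_poly_normal ('X^n - 1 : {poly C}).
move: Dp; rewrite (monicP _) ?monicXnsubC// scale1r => Dp.
have r1 : all n.-unity_root r by apply/allP => z; rewrite -root_prod_XsubC -Dp.
have rn : (n <= size r)%N by rewrite -ltnS -(size_prod_XsubC r id) -Dp size_XnsubC.
have ur : uniq r.
  by rewrite -separable_prod_XsubC -Dp separable_Xn_sub_1// pnatr_eq0 -lt0n.
by have /hasP[z _ zn] := has_prim_root n0 r1 ur rn; exists z.
Qed.

Lemma sum_unity_root_expr (F : fieldType) (n : nat) (z : F) :
  z ^+ n = 1 -> z != 1 -> \sum_(j < n) z ^+ j = 0.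
Proof.
move=> zn z1; apply/eqP; have := subrX1 z n.
by rewrite zn subrr => /esym/eqP; rewrite mulf_eq0 subr_eq0 (negbTE z1).
Qed.

(** Otherwise summing the reversed strict inequalities gives a contradiction. This locates the small
    entries at which sequences are cut. *)
Lemma exists_le_average (R : realType) (f : nat -> R) (n : nat) (d : R) :
  (0 < n)%N -> \sum_(i < n) f i <= d -> exists2 i, (i < n)%N & f i * n%:R <= d.
Proof.
move=> n0 fd; apply: contrapT => H.
have : \sum_(i < n) d < \sum_(i < n) (f i * n%:R).
  apply: ltr_sum => [|i _]; first by apply/hasP; exists (Ordinal n0); rewrite ?mem_index_enum.
  by rewrite ltNge; apply/negP => fi; apply: H; exists i.
rewrite -mulr_suml sumr_const card_ord -[d *+ n]mulr_natr ltr_pM2r ?ltr0n//.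
by rewrite ltNge fd.
Qed.

(** * The squared norm and the discrete Plancherel identity *)

Section InnerProduct.
Context (R : realType) (H : lmodType R[i]) (ip : H -> H -> R[i]).
Hypothesis ipL : forall (a : R[i]) x y z, ip (a *: x + y) z = a * ip x z + ip y z.
Hypothesis ipC : forall x y, ip y x = conjc (ip x y).
Hypothesis ip_ge0 : forall x, 0 <= ip x x.
Hypothesis ip_eq0 : forall x, ip x x = 0 -> x = 0.

Definition nsq (x : H) : R := complex.Re (ip x x).

Lemma ip0l z : ip 0 z = 0.
Proof. by have := ipL 1 0 0 z; rewrite scale1r addr0 mul1r -[LHS]addr0 => /addrI. Qed.

Lemma ipDl x y z : ip (x + y) z = ip x z + ip y z.
Proof. by rewrite -[x in LHS]scale1r ipL mul1r. Qed.

Lemma ipZl a x z : ip (a *: x) z = a * ip x z.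
Proof. by rewrite -[_ *: _]addr0 ipL ip0l addr0. Qed.

Lemma ipDr x y z : ip z (x + y) = ip z x + ip z y.
Proof. by rewrite ipC ipDl rmorphD/= -!ipC. Qed.

Lemma ipZr a x z : ip z (a *: x) = conjc a * ip z x.
Proof. by rewrite ipC ipZl rmorphM/= -ipC. Qed.

Lemma ip_suml (I : Type) (r : seq I) (P : pred I) (f : I -> H) z :
  ip (\sum_(i <- r | P i) f i) z = \sum_(i <- r | P i) ip (f i) z.
Proof. by apply: (big_morph (ip^~ z)); [move=> x y; exact: ipDl | exact: ip0l]. Qed.

Lemma ip_sumr (I : Type) (r : seq I) (P : pred I) (f : I -> H) z :
  ip z (\sum_(i <- r | P i) f i) = \sum_(i <- r | P i) ip z (f i).
Proof.
rewrite ipC ip_suml rmorph_sum/=; apply: eq_bigr => i _.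
by rewrite [RHS]ipC.
Qed.

Lemma ip_nsq x : ip x x = (nsq x)%:C%C.
Proof. by have /ger0_Im := ip_ge0 x; rewrite /nsq; case: (ip x x) => a b /= ->. Qed.

Lemma nsq_ge0 x : 0 <= nsq x.
Proof. by have := ip_ge0 x; rewrite ip_nsq ler0c. Qed.

Lemma nsq0 : nsq 0 = 0.
Proof. by rewrite /nsq ip0l. Qed.

Lemma nsq_eq0 x : nsq x = 0 -> x = 0.
Proof. by move=> x0; apply: ip_eq0; rewrite ip_nsq x0. Qed.

Lemma nsqZ (a : R[i]) x : nsq (a *: x) = (complex.Re `|a|) ^+ 2 * nsq x.
Proof.
apply: (@complexI R); rewrite -ip_nsq ipZl ipZr mulrA -sqr_normc ip_nsq.
rewrite rmorphM rmorphXn.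
by rewrite normc_def.
Qed.

Lemma nsqZr (r : R) x : nsq (r%:C%C *: x) = r ^+ 2 * nsq x.
Proof. by rewrite nsqZ normc_def/= expr0n/= addr0 sqr_sqrtr ?sqr_ge0. Qed.

Lemma nsqN x : nsq (- x) = nsq x.
Proof. by rewrite -scaleN1r nsqZ normrN1 expr1n mul1r. Qed.

Lemma nsqB_sym x y : nsq (x - y) = nsq (y - x).
Proof. by rewrite -nsqN opprB. Qed.

(** Parallelogram law with one nonnegative term dropped. It stands in for the triangle inequality,
    so that the estimates on sequences involve squares only. *)
Lemma nsqD_le x y : nsq (x + y) <= 2 * nsq x + 2 * nsq y.
Proof.
suff <- : nsq (x + y) + nsq (x - y) = 2 * nsq x + 2 * nsq y.
  by rewrite lerDl nsq_ge0.
apply: (@complexI R); rewrite !rmorphD !rmorphM/= -!ip_nsq.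
rewrite -scaleN1r !(ipDl, ipDr, ipZl, ipZr) !rmorphN !rmorph1/=.
ring.
Qed.

Lemma nsqB_le x y : nsq (x - y) <= 2 * nsq x + 2 * nsq y.
Proof. by rewrite -(nsqN y) nsqD_le. Qed.

Lemma hnorm_sqr x : hnorm ip x ^+ 2 = nsq x.
Proof. by rewrite /hnorm sqr_sqrtr// nsq_ge0. Qed.

Lemma hnorm_ge0 x : 0 <= hnorm ip x. Proof. exact: sqrtr_ge0. Qed.

Lemma hnorm_lt x e : 0 < e -> (hnorm ip x < e) = (nsq x < e ^+ 2).
Proof. by move=> e0; rewrite -hnorm_sqr ltr_pXn2r ?nnegrE ?hnorm_ge0 ?ltW. Qed.

Section Fourier.
Context (N : nat) (w : R[i]).
Hypothesis N0 : (0 < N)%N.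
Hypothesis wN : N.-primitive_root w.

Lemma root_norm1 : `|w| = 1.
Proof.
by apply/eqP; rewrite -(@pexpr_eq1 _ _ N)// -normrX prim_expr_order// normr1.
Qed.

Lemma conj_root : conjc w = w^-1.
Proof. by rewrite invc_norm root_norm1 expr1n invr1 mul1r. Qed.

Lemma root_neq0 : w != 0.
Proof. by rewrite -normr_eq0 root_norm1 oner_eq0. Qed.

(** A geometric sum: its ratio [w ^+ k / w ^+ l] is an [N]-th root of unity, and it is 1 exactly
    when [k] and [l] agree modulo [N]. *)
Lemma root_orthogonality (k l : nat) :
  \sum_(j < N) w ^+ (j * k) * conjc w ^+ (j * l) = (N * (k == l %[mod N]))%:R.
Proof.
have w0 := root_neq0.
under eq_bigr => j _ do rewrite mulnC (mulnC j) !exprM -exprMn conj_root.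
rewrite -(eq_prim_root_expr wN); set z := (X in \sum_(_ < _) X ^+ _).
have zN : z ^+ N = 1.
  by rewrite exprMn -!exprM ![(_ * N)%N]mulnC !exprM exprVn
    (prim_expr_order wN) invr1 !expr1n mulr1.
have zE : (z == 1) = (w ^+ k == w ^+ l).
  by rewrite /z exprVn -subr_eq0 -[1](@mulfV _ (w ^+ l)) ?expf_neq0//
    -mulrBl mulf_eq0 invr_eq0 expf_eq0 (negbTE w0) andbF orbF subr_eq0.
case: (eqVneq z 1) zE => [-> <-|z1 <-].
  by under eq_bigr do rewrite expr1n; rewrite sumr_const card_ord muln1.
by rewrite sum_unity_root_expr// muln0.
Qed.

(** Expanding the squares and summing over [j] first leaves only the diagonal terms, by
    orthogonality. The factor [N] comes from the unnormalised transform. *)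
Lemma plancherel (g : nat -> H) :
  \sum_(j < N) nsq (\sum_(k < N) w ^+ (j * k) *: g k)
    = N%:R * \sum_(k < N) nsq (g k).
Proof.
apply: (@complexI R); rewrite rmorph_sum rmorphM/= rmorph_sum/= rmorph_nat.
under eq_bigr => j _ do rewrite -ip_nsq ip_suml.
under [in RHS]eq_bigr => j _ do rewrite -ip_nsq.
rewrite exchange_big/= mulr_sumr; apply: eq_bigr => k _.
under eq_bigr => j _ do rewrite ip_sumr.
rewrite exchange_big/= (bigD1 k)//= [X in _ + X]big1 ?addr0 => [|l lk].
  under eq_bigr => j _ do rewrite ipZl ipZr mulrA rmorphXn.
  by rewrite -mulr_suml root_orthogonality eqxx muln1.
under eq_bigr => j _ do rewrite ipZl ipZr mulrA rmorphXn.
rewrite -mulr_suml root_orthogonality !modn_small//.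
by move: lk; rewrite -val_eqE eq_sym => /negbTE ->; rewrite muln0 mul0r.
Qed.

End Fourier.
End InnerProduct.

(** * Sums over windows of integers *)

Section WindowSums.
Context (R : realType).
Implicit Types (f g : int -> R) (a b k : int) (c d : R) (n : nat).

Definition wsum f a n : R := \sum_(i < n) f (a + i%:Z).

(** For nonnegative [f] this is summability over Z with total at most [c], expressed without
    extended reals. *)
Definition wbound f c := forall a n, wsum f a n <= c.

Lemma wsum_ge0 f a n : (forall k, 0 <= f k) -> 0 <= wsum f a n.
Proof. by move=> f0; apply: sumr_ge0. Qed.

Lemma wsum_cat f a n1 n2 : wsum f a (n1 + n2) = wsum f a n1 + wsum f (a + n1%:Z) n2.
Proof.
rewrite /wsum big_split_ord/=; congr +%R; apply: eq_bigr => i _.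
by rewrite -addrA.
Qed.

Lemma wsum_sub f a n b m : (forall k, 0 <= f k) -> a <= b -> b + m%:Z <= a + n%:Z ->
  wsum f b m <= wsum f a n.
Proof.
move=> f0 ab bn.
have -> : n = (absz (b - a)%R + (m + absz ((a + n%:Z) - (b + m%:Z))%R))%N by lia.
rewrite !wsum_cat (_ : a + (absz (b - a))%:Z = b); last by lia.
by rewrite addrCA lerDl addr_ge0// wsum_ge0.
Qed.

Lemma le_wbound f g c d : (forall k, f k <= g k) -> c <= d -> wbound g c -> wbound f d.
Proof.
move=> fg cd gc a n; apply: le_trans cd; apply: le_trans (gc a n).
by apply: ler_sum.
Qed.

Lemma wboundD f g c d : wbound f c -> wbound g d -> wbound (fun k => f k + g k) (c + d).
Proof. by move=> fc gd a n; rewrite /wsum big_split lerD ?(fc a n) ?(gd a n). Qed.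

Lemma wboundZ f c r : 0 <= r -> wbound f c -> wbound (fun k => r * f k) (r * c).
Proof. by move=> r0 fc a n; rewrite /wsum -mulr_sumr ler_wpM2l//; exact: fc. Qed.

Lemma wbound_shift f c b : wbound f c -> wbound (fun k => f (k + b)) c.
Proof.
move=> fc a n; apply: le_trans (fc (a + b) n).
by apply: ler_sum => i _; rewrite addrAC.
Qed.

Lemma wbound_le f c k : wbound f c -> f k <= c.
Proof. by move=> /(_ k 1%N); rewrite /wsum big_ord1 addr0. Qed.

Lemma wbound_supp f b m : (forall k, 0 <= f k) ->
  (forall k, ~~ (b <= k < b + m%:Z) -> f k = 0) -> wbound f (wsum f b m).
Proof.
move=> f0 fz a n.
have [h [p [ha [hb [pa pb]]]]] : exists h (p : nat),
    h <= a /\ h <= b /\ a + n%:Z <= h + p%:Z /\ b + m%:Z <= h + p%:Z.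
  exists (a - (absz (a - b))%:Z), (absz (a - b)%R + absz (a-b)%R + n + m)%N; lia.
apply: (le_trans (wsum_sub f0 ha pa)).
have -> : p = (absz (b - h)%R + (m + absz ((h + p%:Z) - (b + m%:Z))%R))%N by lia.
rewrite !wsum_cat (_ : h + (absz (b - h))%:Z = b); last by lia.
rewrite [wsum f h _]big1 => [|i _]; last by apply: fz; have := ltn_ord i; lia.
by rewrite add0r [X in _ + X]big1 ?addr0// => i _; apply: fz; lia.
Qed.

(** A window whose sum is within [e] of the supremum of all window sums leaves at most [e] outside
    it. *)
Lemma wbound_tail f d (e : R) : (forall k, 0 <= f k) -> wbound f d -> 0 < e ->
  exists a n, wbound (fun k => if a <= k < a + n%:Z then 0 else f k) e.
Proof.
move=> f0 fd e0.
pose E := [set wsum f p.1 p.2 | p in [set: int * nat]].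
have supE : has_sup E.
  split; first by exists (wsum f 0 0), (0, 0%N).
  by exists d => _ [[a n] _ <-]; exact: fd.
have [_ [[a n] _ <-] /= sE] := sup_adherent e0 supE.
exists a, n => b m; set g := fun k => _.
have g0 k : 0 <= g k by rewrite /g; case: ifP.
(* A common window around both: there the sum of [g] and that of [f] over the chosen window add up
   to at most one window sum of [f]. *)
have [h [p [ha [hb [pa pb]]]]] : exists h (p : nat),
    h <= a /\ h <= b /\ a + n%:Z <= h + p%:Z /\ b + m%:Z <= h + p%:Z.
  exists (a - (absz (a - b))%:Z), (absz (a - b)%R + absz (a-b)%R + n + m)%N; lia.
apply: (le_trans (wsum_sub g0 hb pb)).
have H : wsum g h p + wsum f a n <= wsum f h p.
  have Ep : p = (absz (a - h)%R + (n + absz ((h + p%:Z) - (a + n%:Z))%R))%N by lia.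
  rewrite {1 2}Ep !wsum_cat (_ : h + (absz (a - h))%:Z = a); last by lia.
  rewrite [wsum g a n]big1 => [|i _]; last by rewrite /g ifT//; have := ltn_ord i; lia.
  rewrite add0r addrAC -addrA lerD ?lerD2l//.
    by apply: ler_sum => i _; rewrite /g; case: ifP.
  by apply: ler_sum => i _; rewrite /g; case: ifP.
have : wsum f h p <= sup E by apply: ub_le_sup; [case: supE|exists (h, p)].
lra.
Qed.

End WindowSums.

(** * The operator [rho tau - A] *)

Section WeightedShift.
Context (R : realType) (H : lmodType R[i]) (A : {linear H -> H}) (rho : R).

Definition shift_nat (w : nat -> H) (k : nat) : H := rho%:C%C *: w k.+1 - A (w k).

Definition shift_op (W : int -> H) (k : int) : H := rho%:C%C *: W (k + 1) - A (W k).

Lemma shift_opB W V k : shift_op (fun k => W k - V k) k = shift_op W k - shift_op V k.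
Proof. by rewrite /shift_op scalerBr linearB/= !opprD opprK addrACA. Qed.

(* Cutting a periodic solution just after index [k0] leaves a defect only at the
   two ends of the window. *)
Lemma shift_op_cut (p v : nat -> H) (a : int) (L N k0 : nat) :
  (L <= k0 < N)%N -> (forall k, p (k + N)%N = p k) ->
  (forall k, shift_nat p k = v (k %% N)%N) -> (forall l, (L <= l)%N -> v l = 0) ->
  let c1 := a + k0%:Z - N%:Z in let c2 := a + k0%:Z in
  forall k : int,
  shift_op (fun k => if c1 < k <= c2 then p (absz (k - a + N%:Z)) else 0) k =
    if k == c1 then A (p k0) else if k == c2 then - A (p k0) else
    if a <= k < a + L%:Z then v (absz (k - a)%R) else 0.
Proof.
move=> /andP[Lk kN] pN pv v0 c1 c2 k; rewrite /shift_op {}/c1 {}/c2.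
have [kc1|kc1] := eqVneq k (a + k0%:Z - N%:Z).
  rewrite ifT; last by lia.
  rewrite ifN; last by lia.
  (* The first retained entry is [p k0.+1]. As [L <= k0], the periodic equation at [k0] has
     right-hand side 0, so [rho] times this entry is [A (p k0)]. *)
  rewrite linear0 subr0 (_ : absz _ = k0.+1); last by lia.
  apply/eqP; rewrite -subr_eq0; apply/eqP; rewrite [LHS]pv modn_small//.
  exact: v0.
have [kc2|kc2] := eqVneq k (a + k0%:Z).
  rewrite ifN; last by lia.
  rewrite ifT; last by lia.
  rewrite scaler0 sub0r (_ : absz _ = (k0 + N)%N) ?pN//; lia.
have [kc|kc] := boolP (a + k0%:Z - N%:Z < k < a + k0%:Z); last first.
  rewrite ifN; last by lia.
  rewrite ifN; last by lia.
  rewrite ifN; last by lia.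
  by rewrite scaler0 linear0 subr0.
rewrite ifT; last by lia.
rewrite ifT; last by lia.
rewrite (_ : absz (k + 1 - a + N%:Z)%R = (absz (k - a + N%:Z)).+1); last by lia.
rewrite [LHS]pv; have [kL|kL] := boolP (a <= k < a + L%:Z).
  rewrite (_ : absz (k - a + N%:Z)%R = (N + absz (k - a)%R)%N); last by lia.
  by rewrite modnDl modn_small//; lia.
apply: v0; have [kn|kn] := ltnP (absz (k - a + N%:Z)) N.
  by rewrite modn_small//; lia.
rewrite (_ : absz (k - a + N%:Z)%R = (N + absz (k - a)%R)%N); last by lia.
by rewrite modnDl modn_small; lia.
Qed.

End WeightedShift.

(** * A priori bound, dense range and surjectivity in unweighted l2 *)

Section Operator.
Context (R : realType) (H : lmodType R[i]) (ip : H -> H -> R[i]).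
Hypothesis ipL : forall (a : R[i]) x y z, ip (a *: x + y) z = a * ip x z + ip y z.
Hypothesis ipC : forall x y, ip y x = conjc (ip x y).
Hypothesis ip_ge0 : forall x, 0 <= ip x x.
Hypothesis ip_eq0 : forall x, ip x x = 0 -> x = 0.
Local Notation nsq := (nsq ip).
Let nsq_ge0 := nsq_ge0 ip_ge0.
Let nsqZr := nsqZr ipL ipC ip_ge0.
Let nsqN := nsqN ipL ipC ip_ge0.
Let nsqB_le := nsqB_le ipL ipC ip_ge0.
Let nsqD_le := nsqD_le ipL ipC ip_ge0.
Let nsq0 := nsq0 ipL.
Let nsqB_sym := nsqB_sym ipL ipC ip_ge0.
Let nsq_eq0 := nsq_eq0 ip_ge0 ip_eq0.

Context (A : {linear H -> H}) (rho M K : R).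
Hypothesis K_ge0 : 0 <= K.
Hypothesis A_le : forall x, nsq (A x) <= K * nsq x.
Hypothesis resolvent : forall s : R[i], `|s| = 1 -> exists B : {linear H -> H},
  [/\ forall x, B ((rho%:C%C * s) *: x - A x) = x,
      forall y, (rho%:C%C * s) *: B y - A (B y) = y &
      forall x, nsq (B x) <= M ^+ 2 * nsq x].

Local Notation shift_nat := (shift_nat A rho).
Local Notation shift_op := (shift_op A rho).

(** In Fourier mode [j] the operator is [rho * z ^- j - A], whose inverse is bounded by [M];
    Plancherel on both sides carries the modewise bound back with the same constant. *)
Lemma periodic_bound N (w : nat -> H) : w N = w 0%N ->
  \sum_(k < N) nsq (w k) <= M ^+ 2 * \sum_(k < N) nsq (shift_nat w k).
Proof.
case: (posnP N) => [->|N0] wN; first by rewrite !big_ord0 mulr0.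
have [z zN] := @prim_root_exists R[i] _ N0.
have z0 := root_neq0 N0 zN.
rewrite -(@ler_pM2l _ N%:R) ?ltr0n// mulrCA.
rewrite -!(plancherel ipL ipC ip_ge0 N0 zN) mulr_sumr.
apply: ler_sum => j _.
set wh := \sum_(k < N) _ *: w k.
have sh : \sum_(k < N) z ^+ (j * k) *: w k.+1 = z ^- j *: wh.
  apply: (canRL (scalerK _)); first by rewrite expf_neq0.
  rewrite scaler_sumr.
  under eq_bigr => k _ do rewrite scalerA -exprD -mulnS.
  (* Adding the term of index 0 turns the left side into the sum over 0..N, whose last term equals
     the added one since [w N = w 0] and [z ^+ N = 1]. *)
  apply/eqP; rewrite -(inj_eq (addrI (z ^+ (j * 0) *: w 0%N))).
  rewrite -(big_ord_recl N (fun k => z ^+ (j * k) *: w k)) big_ord_recr/=.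
  by rewrite wN muln0 mulnC exprM (prim_expr_order zN) expr1n addrC.
have -> : \sum_(k < N) z ^+ (j * k) *: shift_nat w k = (rho%:C%C * z ^- j) *: wh - A wh.
  rewrite -scalerA -sh [A wh]linear_sum scaler_sumr -sumrB.
  apply: eq_bigr => k _; rewrite /shift_nat scalerBr [A (_ *: _)]linearZ/=.
  by rewrite !scalerA [_ * rho%:C%C]mulrC.
have [|B [B1 _ B2]] := @resolvent (z ^- j).
  by rewrite normrV ?unitfE ?expf_neq0// normrX (root_norm1 N0 zN) expr1n invr1.
by rewrite -[in leLHS](B1 wh).
Qed.

Lemma periodic_solution N (v : nat -> H) : (0 < N)%N ->
  exists p : nat -> H, (forall k, p (k + N)%N = p k) /\
    (forall k, shift_nat p k = v (k %% N)%N).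
Proof.
move=> N0; have [z zN] := @prim_root_exists R[i] _ N0.
have z0 := root_neq0 N0 zN.
have [B BP] : exists B : nat -> {linear H -> H}, forall (j : nat) y,
    (rho%:C%C * z ^+ j) *: B j y - A (B j y) = y.
  suff /choice[B ?] : forall j : nat, exists B : {linear H -> H},
    forall y, (rho%:C%C * z ^+ j) *: B y - A (B y) = y by exists B.
  move=> j; have [|B [_ B1 _]] := @resolvent (z ^+ j).
    by rewrite normrX (root_norm1 N0 zN) expr1n.
  by exists B.
(* The transform uses conjugate roots, so that inversion uses [z ^+ (j * k)]; a shift then
   multiplies mode [j] by [z ^+ j], which [B j] inverts. *)
pose vh (j : nat) := \sum_(l < N) conjc z ^+ (j * l) *: v l.
exists (fun k => N%:R^-1 *: \sum_(j < N) z ^+ (j * k) *: B j (vh j)).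
split=> k.
  congr (_ *: _); apply: eq_bigr => j _; rewrite mulnDr exprD (mulnC j N) [z ^+ (N * j)]exprM.
  by rewrite (prim_expr_order zN) expr1n mulr1.
rewrite /shift_nat [A (_ *: _)]linearZ/= scalerA [rho%:C%C * _]mulrC -scalerA -scalerBr
  [A (\sum_(_ < _) _)]linear_sum scaler_sumr -sumrB.
under eq_bigr => j _.
  rewrite [A (_ *: _)]linearZ/= scalerA mulnS addnC exprD mulrCA -scalerA -scalerBr
    BP /vh scaler_sumr.
  under eq_bigr do rewrite scalerA.
  over.
rewrite exchange_big/=.
under eq_bigr => l _ do rewrite -scaler_suml (root_orthogonality N0 zN).
have kN : (k %% N < N)%N by rewrite ltn_mod.
rewrite (bigD1 (Ordinal kN))//= big1 ?addr0 => [|l lk].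
  by rewrite modn_mod eqxx muln1 scalerA mulVf ?scale1r// pnatr_eq0 -lt0n.
rewrite (modn_small (ltn_ord l)) eq_sym.
by move: lk; rewrite -val_eqE/= => /negbTE ->; rewrite muln0 scale0r.
Qed.

(* Padding with zeros on both sides makes the window periodic; the two extra
   terms are the jumps at its ends. *)
Lemma window_bound (w : nat -> H) n :
  \sum_(i < n.+1) nsq (w i) <= M ^+ 2 *
    (\sum_(i < n) nsq (shift_nat w i) + rho ^+ 2 * nsq (w 0%N) + K * nsq (w n)).
Proof.
pose u k := if k is k'.+1 then (if (k' <= n)%N then w k' else 0) else 0.
have := @periodic_bound n.+2 u; rewrite /= ltnn => /(_ erefl).
rewrite big_ord_recl/= nsq0 add0r.
rewrite (eq_bigr (fun i : 'I_n.+1 => nsq (w i))); last first.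
  by move=> i _; rewrite /bump/= -ltnS ltn_ord.
move=> /le_trans; apply; rewrite ler_wpM2l ?sqr_ge0//.
rewrite big_ord_recl big_ord_recr/= {1}/shift_nat/= linear0 subr0 nsqZr.
rewrite addrA [X in X + _]addrC lerD//; last first.
  by rewrite /shift_nat/= leqnn ltnn scaler0 sub0r nsqN.
rewrite lerD2r ler_sum// => i _; rewrite /shift_nat/= /bump/= !add1n ltn_ord.
by rewrite add0n ltnW.
Qed.

(** Any window extends on both sides to one ending at small entries, where [window_bound] has
    negligible boundary terms. The bound [d] supplies such entries but does not enter the final
    constant. *)
Lemma shift_op_apriori W d c : wbound (nsq \o W) d -> wbound (nsq \o shift_op W) c ->
  wbound (nsq \o W) (M ^+ 2 * c).
Proof.
move=> Wd Tc a n; apply/ler_addgt0Pr => e e0.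
have g0 : 0 < M ^+ 2 * (rho ^+ 2 + K) + 1 by rewrite ltr_wpDl// mulr_ge0 ?addr_ge0 ?sqr_ge0.
(* Two end entries of square at most [e'] cost at most [M ^+ 2 * (rho ^+ 2 + K) * e'], hence at most
   [e]; the 1 keeps the denominator positive. *)
pose e' := e / (M ^+ 2 * (rho ^+ 2 + K) + 1).
have e'0 : 0 < e' by rewrite divr_gt0.
(* By averaging, a block longer than [|d| / e'] contains a small entry. The start depends on the
   length because the left block must end just before [a]. *)
have small b : exists (m i : nat), (i < m)%N /\ nsq (W (b m + i%:Z)) <= e'.
  pose m := (Num.truncn (`|d| / e')).+1.
  have dm : `|d| < m%:R * e' by rewrite -ltr_pdivrMr// truncnS_gt.
  have [|i im H1] := @exists_le_average _ (fun i => nsq (W (b m + i%:Z))) m d (ltn0Sn _).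
    exact: Wd.
  exists m, i; split=> //; rewrite -(@ler_pM2r _ m%:R) ?ltr0n//.
  by apply: (le_trans H1); rewrite mulrC (le_trans (ler_norm _)) ?ltW.
have [m1 [i1 [im1 s1]]] := small (fun m => a - m%:Z).
have [m2 [i2 [im2 s2]]] := small (fun m => a + n%:Z).
pose b := a - m1%:Z + i1%:Z; pose N := ((m1 - i1) + n + i2)%N.
have := window_bound (fun k => W (b + k%:Z)) N.
have bN : b + N%:Z = a + n%:Z + i2%:Z by rewrite /b /N; lia.
rewrite addr0 bN => H1.
have nW k : 0 <= (nsq \o W) k by apply: nsq_ge0.
apply: le_trans (@wsum_sub _ (nsq \o W) b N.+1 _ _ nW _ _) _.
- by rewrite /b; lia.
- by rewrite /b /N; lia.
apply: le_trans H1 _; rewrite -addrA mulrDr lerD//.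
  rewrite ler_wpM2l ?sqr_ge0//; apply: le_trans (Tc b N).
  by apply: ler_sum => i _; rewrite /shift_nat /shift_op /= (_ : b + i.+1%:Z = b + i%:Z + 1)//; lia.
have -> : e = (M ^+ 2 * (rho ^+ 2 + K) + 1) * e' by rewrite /e' mulrC divfK// gt_eqF.
rewrite mulrDl mul1r -mulrA.
rewrite -[leLHS]addr0; apply: lerD; last exact: ltW.
rewrite ler_wpM2l ?sqr_ge0// mulrDl.
by rewrite lerD// ler_wpM2l// sqr_ge0.
Qed.

Lemma nsq_shift_op_le W k :
  nsq (shift_op W k) <= 2 * rho ^+ 2 * nsq (W (k + 1)) + 2 * K * nsq (W k).
Proof.
apply: le_trans (nsqB_le _ _) _; rewrite nsqZr -!mulrA.
by rewrite lerD// ler_wpM2l// A_le.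
Qed.

Lemma wbound_shift_op W d : wbound (nsq \o W) d ->
  wbound (nsq \o shift_op W) (2 * rho ^+ 2 * d + 2 * K * d).
Proof.
move=> Wd; apply: (le_wbound (nsq_shift_op_le W) (lexx _)).
apply: wboundD; apply: wboundZ.
- by rewrite mulr_ge0 ?sqr_ge0.
- exact: (@wbound_shift _ (nsq \o W) d 1 Wd).
- by rewrite mulr_ge0.
- exact: Wd.
Qed.

Lemma wboundB W V d c : wbound (nsq \o W) d -> wbound (nsq \o V) c ->
  wbound (nsq \o (fun k => W k - V k)) (2 * d + 2 * c).
Proof.
move=> Wd Vc; apply: (le_wbound _ (lexx _)); first by move=> k; exact: nsqB_le.
by apply: wboundD; apply: wboundZ.
Qed.

Lemma wbound_point k0 (x : R) : 0 <= x -> wbound (fun k => if k == k0 then x else 0) x.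
Proof.
move=> x0.
have := @wbound_supp R (fun k => if k == k0 then x else 0) k0 1.
rewrite /wsum big_ord1 addr0 eqxx; apply=> k; first by case: ifP.
by move=> kk; rewrite ifN//; lia.
Qed.

Lemma shift_op_dense_range v d e : wbound (nsq \o v) d -> 0 < e ->
  exists W, (exists d', wbound (nsq \o W) d') /\
    wbound (nsq \o (fun k => shift_op W k - v k)) e.
Proof.
move=> vd e0.
have vn k : 0 <= (nsq \o v) k by exact: nsq_ge0.
have [a [L tail]] := wbound_tail vn vd (divr_gt0 e0 (ltr0n _ 4)).
pose v' l := if (l < L)%N then v (a + l%:Z) else 0.
(* [m] zeros follow the [L] kept entries of [v]. Averaging over these slots gives a cut index [k0]
   with [K * nsq (p k0)] at most [e / 8]. *)
pose m := (Num.truncn (8 * K * (M ^+ 2 * d) / e)).+1.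
have em : 8 * K * (M ^+ 2 * d) < m%:R * e by rewrite -ltr_pdivrMr// truncnS_gt.
have [|p [pN pv]] := @periodic_solution (L + m) v'; first by rewrite addnS.
have pd : \sum_(k < L + m) nsq (p k) <= M ^+ 2 * d.
  apply: le_trans (periodic_bound _) _; first by rewrite -[(L + m)%N]add0n pN.
  rewrite ler_wpM2l ?sqr_ge0//; apply: le_trans (vd a L).
  rewrite big_split_ord/= [X in _ + X]big1 ?addr0 => [|i _]; last first.
    by rewrite pv modn_small ?ltn_add2l// /v' ltnNge leq_addr/= nsq0.
  apply: ler_sum => i _.
  by rewrite pv modn_small ?ltn_addr// /v' ltn_ord.
have [|i im pi] := @exists_le_average _ (fun i => nsq (p (L + i)%N)) m (M ^+ 2 * d) (ltn0Sn _).
  by apply: le_trans pd; rewrite big_split_ord/= lerDr sumr_ge0.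
pose k0 := (L + i)%N; pose N := (L + m)%N.
have k0N : (k0 < N)%N by rewrite ltn_add2l.
pose x := K * nsq (p k0).
have x0 : 0 <= x by rewrite mulr_ge0.
have xe : 8 * x <= e.
  rewrite -(@ler_pM2l _ m%:R) ?ltr0n//; apply: le_trans (ltW em).
  have -> : m%:R * (8 * x) = 8 * K * (nsq (p k0) * m%:R) by rewrite /x; ring.
  by rewrite ler_wpM2l// mulr_ge0.
pose c1 := a + k0%:Z - N%:Z; pose c2 := a + k0%:Z.
pose W (k : int) := if c1 < k <= c2 then p (absz (k - a + N%:Z)) else 0.
exists W; split.
  exists (wsum (nsq \o W) (c1 + 1) N); apply: wbound_supp => k.
    exact: nsq_ge0.
  by move=> kk; rewrite /= /W ifN ?nsq0//; apply: contra kk; rewrite /c1 /c2; clear; lia.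
pose vt k := if a <= k < a + L%:Z then 0 else v k.
pose er k := if k == c1 then A (p k0) else if k == c2 then - A (p k0) else 0.
have key k : shift_op W k - v k = er k - vt k.
  have v'0 l : (L <= l)%N -> v' l = 0 by rewrite /v' leqNgt => /negbTE ->.
  have Lk0 : (L <= k0 < N)%N by rewrite leq_addr.
  rewrite (shift_op_cut a Lk0 pN pv v'0 k) -/c1 -/c2 /er /vt.
  have [ka|ka] := boolP (a <= k < a + L%:Z); last first.
    by case: (k == c1); case: (k == c2).
  have kc1 : k != c1 by move: ka k0N; rewrite /c1; clear; lia.
  have kc2 : k != c2 by move: ka; rewrite /c2 /k0; clear; lia.
  have kL : (absz (k - a) < L)%N by move: ka; clear; lia.
  rewrite (negbTE kc1) (negbTE kc2) subr0 /v' kL.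
  by rewrite (_ : a + _ = k) ?subrr//; move: ka; clear; lia.
pose bd (k : int) := 2 * ((if k == c1 then x else 0) + (if k == c2 then x else 0))
  + 2 * (if a <= k < a + L%:Z then 0 else (nsq \o v) k).
(* The two cut defects contribute [4 * x], at most [e / 2], and the discarded tail of [v]
   contributes [e / 2]. *)
have bdP : wbound bd (2 * (x + x) + 2 * (e / 4)).
  apply: wboundD; apply: wboundZ => //.
  by apply: wboundD; exact: wbound_point.
apply: (le_wbound _ _ bdP); last by lra.
move=> k; rewrite /= key; apply: le_trans (nsqB_le _ _) _.
rewrite /bd lerD// ler_wpM2l//; last by rewrite /vt; case: ifP; rewrite ?nsq0.
rewrite /er; have Ax := A_le (p k0).
case: eqP => _; first by rewrite (le_trans Ax)// lerDl; case: ifP.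
by case: eqP => _; rewrite ?nsqN ?nsq0 add0r.
Qed.

Hypothesis complete : forall u : nat -> H,
  (forall e : R, 0 < e -> exists N : nat, forall m n : nat,
    (N <= m)%N -> (N <= n)%N -> nsq (u m - u n) <= e) ->
  exists l : H, forall e : R, 0 < e -> exists N : nat, forall n : nat,
    (N <= n)%N -> nsq (u n - l) <= e.

Lemma small_inv (c e : R) : 0 <= c -> 0 < e ->
  exists N : nat, forall n : nat, (N <= n)%N -> c / n.+1%:R <= e.
Proof.
move=> c0 e0; exists (Num.truncn (c / e)) => n Nn.
rewrite ler_pdivrMr ?ltr0n// mulrC -ler_pdivrMr//.
by apply/ltW/(lt_le_trans (truncnS_gt _)); rewrite ler_nat.
Qed.

(** Approximate solutions with defect tending to 0 are Cauchy by the a priori bound; their entrywise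
    limit is an l2 limit and solves the equation. *)
Lemma shift_op_surjective v d : wbound (nsq \o v) d ->
  exists W, (exists d', wbound (nsq \o W) d') /\ (forall k, shift_op W k = v k).
Proof.
move=> vd.
have /choice[W WP] : forall j : nat, exists W, (exists d', wbound (nsq \o W) d') /\
    wbound (nsq \o (fun k => shift_op W k - v k)) j.+1%:R^-1.
  by move=> j; apply: shift_op_dense_range vd _; rewrite invr_gt0 ltr0n.
have diff i j : wbound (nsq \o (fun k => W i k - W j k))
    (M ^+ 2 * (2 * i.+1%:R^-1 + 2 * j.+1%:R^-1)).
  have [[di Wi] Ti] := WP i; have [[dj Wj] Tj] := WP j.
  apply: (shift_op_apriori (wboundB Wi Wj)); apply: le_wbound (wboundB Ti Tj) => // k.
  by rewrite /= shift_opB [- (_ - v k)]opprB subrKA.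
have M2 : 0 <= M ^+ 2 by rewrite sqr_ge0.
have diff_le i j : (i <= j)%N -> wbound (nsq \o (fun k => W i k - W j k))
    (4 * M ^+ 2 / i.+1%:R).
  move=> ij; apply: le_wbound (diff i j) => //.
  have : j.+1%:R^-1 <= i.+1%:R^-1 :> R by rewrite lef_pV2 ?posrE ?ltr0n// ler_nat.
  move=> /(ler_wpM2l M2); move: (M ^+ 2) (i.+1%:R^-1) (j.+1%:R^-1) => A1 A2 A3; lra.
have /choice[l lP] : forall k, exists l : H, forall e : R, 0 < e ->
    exists N : nat, forall n : nat, (N <= n)%N -> nsq (W n k - l) <= e.
  move=> k; apply: complete => e e0.
  have [|N NP] := @small_inv (4 * M ^+ 2) e _ e0; first by rewrite mulr_ge0.
  exists N => m n Nm Nn; have [mn|/ltnW nm] := leqP m n.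
    by apply: le_trans (NP m Nm); exact: (wbound_le k (diff_le _ _ mn)).
  rewrite nsqB_sym; apply: le_trans (NP n Nn).
  exact: (wbound_le k (diff_le _ _ nm)).
(* Entrywise convergence is uniform on a finite window only. The Cauchy estimate, whose constant
   does not depend on the window, then upgrades it to [lim_bound]. *)
have lim_window a n e : 0 < e -> exists N : nat, forall j, (N <= j)%N ->
    wsum (nsq \o (fun k => W j k - l k)) a n <= e.
  elim: n e => [|n IH] e e0.
    by exists 0%N => j _; rewrite /wsum big_ord0 ltW.
  have e2 : 0 < e / 2 by rewrite divr_gt0.
  have [N1 N1P] := IH _ e2; have [N2 N2P] := lP (a + n%:Z) _ e2.
  exists (maxn N1 N2) => j; rewrite geq_max => /andP[j1 j2].
  rewrite /wsum big_ord_recr/= [leRHS]splitr.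
  by apply: lerD; [exact: N1P|exact: N2P].
have lim_bound j : wbound (nsq \o (fun k => W j k - l k)) (8 * M ^+ 2 / j.+1%:R).
  move=> a n; apply/ler_addgt0Pr => e e0.
  have [N NP] := lim_window a n _ (divr_gt0 e0 (ltr0n _ 2)).
  pose i := maxn N j.
  have H1 := NP i (leq_maxl _ _); have H2 := diff_le j i (leq_maxr _ _) a n.
  apply: (@le_trans _ _ (2 * wsum (nsq \o (fun k => W j k - W i k)) a n +
                         2 * wsum (nsq \o (fun k => W i k - l k)) a n)).
    rewrite /wsum !mulr_sumr -big_split/=; apply: ler_sum => m _.
    apply: le_trans (nsqD_le _ _).
    by rewrite subrKA.
  have c0 : 0 <= 2 :> R by [].
  apply: le_trans (lerD (ler_wpM2l c0 H2) (ler_wpM2l c0 H1)) _.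
  move: (M ^+ 2) (j.+1%:R^-1) => A1 A2; lra.
exists l; split.
  have [[d0 W0] _] := WP 0%N.
  exists (2 * d0 + 2 * (8 * M ^+ 2 / 1%:R)).
  apply: le_wbound (wboundB W0 (lim_bound 0%N)) => // k.
  by rewrite /= opprB addrC subrK.
move=> k; apply/eqP; rewrite -subr_eq0; apply/eqP/nsq_eq0/eqP.
rewrite eq_le nsq_ge0 andbT; apply/ler_addgt0Pr => e e0; rewrite add0r.
pose c := 8 * M ^+ 2.
have c0 : 0 <= c by rewrite mulr_ge0.
(* The defect of [l] is that of [W N] minus [shift_op] of [W N - l]; the constant collects the
   bounds of [wboundB] and [wbound_shift_op], each of order [1 / N.+1]. *)
have [|N /(_ N (leqnn _)) NP] := @small_inv (2 + 2 * (2 * rho ^+ 2 * c + 2 * K * c)) e _ e0.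
  have rc : 0 <= rho ^+ 2 * c by rewrite mulr_ge0 ?sqr_ge0.
  have Kc : 0 <= K * c by rewrite mulr_ge0.
  lra.
apply: le_trans NP; have [_ TN] := WP N.
have := wbound_le k (wboundB TN (wbound_shift_op (lim_bound N))).
have -> : (fun k => shift_op (W N) k - v k - shift_op (fun k => W N k - l k) k)
    = fun k => shift_op l k - v k.
  by apply/funext => j; rewrite shift_opB [- (_ - shift_op l j)]opprB addrC subrKA.
move=> /le_trans; apply.
rewrite /c; move: (M ^+ 2) (N.+1%:R^-1) => A1 A2; lra.
Qed.

End Operator.

(** * Window bounds and unordered sums over Z *)

Section WindowEsum.
Context (R : realType) (f : int -> R).
Hypothesis f0 : forall k, 0 <= f k.

Let window (a : int) (n : nat) : seq int := [seq a + i%:Z | i <- iota 0 n].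

Lemma fsum_window (a : int) n :
  (\sum_(x \in [set` window a n]) (f x)%:E)%E = (wsum f a n)%:E.
Proof.
rewrite -fsbig_seq; last by rewrite map_inj_uniq ?iota_uniq// => i j; lia.
by rewrite big_map sumEFin /wsum -(big_mkord xpredT (fun i => f (a + i%:Z))) /index_iota subn0.
Qed.

(** Windows are finite sets, and conversely every finite set of integers lies in a symmetric window,
    where nonnegative terms only add to the sum. *)
Lemma esum_le_wbound c :
  (\esum_(k in [set: int]) (f k)%:E <= c%:E)%E <-> wbound f c.
Proof.
split=> [fc a n|fc].
  rewrite -lee_fin; apply: le_trans fc; apply: ereal_sup_ubound.
  exists [set` window a n]; last exact: fsum_window.
  by split=> //; exact: finite_seq.
apply: ge_ereal_sup => _ [X [/finite_seqP[s ->] _] <-].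
pose N := (\max_(k <- s) absz k)%N.
apply: (@le_trans _ _ (wsum f (- N%:Z) N.*2.+1)%:E); last by rewrite lee_fin.
rewrite -fsum_window; apply: lee_fsum_nneg_subset => [||k ks|k _].
- exact: finite_seq.
- exact: finite_seq.
- move: ks; rewrite !inE/= => ks; rewrite /window; apply/mapP; exists (absz (k + N%:Z)).
    have := @leq_bigmax_seq _ s xpredT absz k ks erefl; rewrite -/N mem_iota; lia.
  have := @leq_bigmax_seq _ s xpredT absz k ks erefl; rewrite -/N; lia.
- by rewrite lee_fin.
Qed.

End WindowEsum.

(** * The resolvent bound *)

Section Resolvent.
Context (R : realType) (H : lmodType R[i]) (ip : H -> H -> R[i]).
Hypothesis ipL : forall (a : R[i]) x y z, ip (a *: x + y) z = a * ip x z + ip y z.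
Hypothesis ipC : forall x y, ip y x = conjc (ip x y).
Hypothesis ip_ge0 : forall x, 0 <= ip x x.
Hypothesis ip_eq0 : forall x, ip x x = 0 -> x = 0.
Local Notation nsq := (nsq ip).
Local Notation hnorm := (hnorm ip).

Lemma hnorm_le_sqrt x y (c : R) : 0 <= c -> nsq x <= c * nsq y ->
  hnorm x <= Num.sqrt c * hnorm y.
Proof. by move=> c0 xy; rewrite /Defs.hnorm -sqrtrM// ler_wsqrtr. Qed.

Lemma bounded_op_nsq (B : H -> H) : bounded_op ip B ->
  exists2 c : R, 0 <= c & forall x, nsq (B x) <= c * nsq x.
Proof.
move=> [c Bc]; exists (c ^+ 2) => [|x]; first exact: sqr_ge0.
rewrite -!(hnorm_sqr ip_ge0) -exprMn ler_sqr ?nnegrE ?hnorm_ge0//.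
by rewrite (le_trans _ (Bc x))// hnorm_ge0.
Qed.

Lemma opnorm_le (B : {linear H -> H}) (c : R) : 0 <= c ->
  (forall x, nsq (B x) <= c ^+ 2 * nsq x) -> opnorm ip B <= c.
Proof.
move=> c0 Bc; apply: ge_sup.
  by exists (hnorm (B 0)), 0 => //=; rewrite /Defs.hnorm (ip0l ipL) sqrtr0.
move=> _ [x /= x1 <-]; have := hnorm_le_sqrt (sqr_ge0 c) (Bc x).
move=> /le_trans; apply; rewrite sqrtr_sqr ger0_norm//.
by rewrite ler_piMr.
Qed.

(** Boundedness makes the supremum in [opnorm] genuine, and a nonzero [x] rescaled to norm 1 is one
    of its competitors. *)
Lemma nsq_opnorm (B : {linear H -> H}) x : bounded_op ip B ->
  nsq (B x) <= opnorm ip B ^+ 2 * nsq x.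
Proof.
move=> [c Bc]; have [x0|x0] := eqVneq (nsq x) 0.
  by rewrite (nsq_eq0 ip_ge0 ip_eq0 x0) linear0 (nsq0 ipL) mulr0.
have hx : 0 < hnorm x by rewrite sqrtr_gt0 lt_neqAle eq_sym x0 nsq_ge0.
have hZ (r : R) y : 0 <= r -> hnorm (r%:C%C *: y) = r * hnorm y.
  move=> r0; rewrite /Defs.hnorm -/(nsq _) (nsqZr ipL ipC ip_ge0).
  by rewrite sqrtrM ?sqr_ge0// sqrtr_sqr ger0_norm.
have hB : hnorm (B x) <= opnorm ip B * hnorm x.
  rewrite -ler_pdivrMr// mulrC -hZ ?invr_ge0 ?(ltW hx)// -linearZ.
  rewrite /opnorm; apply: ub_le_sup.
    exists `|c| => _ [y /= y1 <-]; apply: (le_trans (Bc y)).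
    apply: (le_trans (ler_wpM2r _ (ler_norm c))); first exact: hnorm_ge0.
    by rewrite ler_piMr.
  exists ((hnorm x)^-1%:C%C *: x) => //=.
  by rewrite hZ ?invr_ge0 ?(ltW hx)// mulVf// gt_eqF.
rewrite -!(hnorm_sqr ip_ge0) -exprMn ler_sqr ?nnegrE ?hnorm_ge0//.
by rewrite (le_trans _ hB)// hnorm_ge0.
Qed.

(** From [B x = B0 (x + (z0 - z) *: B x)], the second term contributes at most half of [nsq (B x)]
    when [z] is close to [z0], and is absorbed on the left. *)
Lemma resolvent_local_bound (A B B0 : {linear H -> H}) (z z0 : R[i]) (C : R) :
  0 <= C -> (forall x, nsq (B0 x) <= C * nsq x) ->
  (forall x, B0 (z0 *: x - A x) = x) -> (forall y, z *: B y - A (B y) = y) ->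
  4 * C * complex.Re `|z0 - z| ^+ 2 <= 1 ->
  forall x, nsq (B x) <= 4 * C * nsq x.
Proof.
move=> C0 B0C B0l Br small x.
have E : z0 *: B x - A (B x) = x + (z0 - z) *: B x.
  by rewrite -[X in _ = X + _](Br x) scalerBl [RHS]addrC subrKA.
have := B0C (z0 *: B x - A (B x)); rewrite B0l E => H1.
have H2 := nsqD_le ipL ipC ip_ge0 x ((z0 - z) *: B x).
rewrite (nsqZ ipL ipC ip_ge0) in H2.
have := ler_wpM2l C0 H2.
have := ler_wpM2r (nsq_ge0 ip_ge0 (B x)) small.
move: H1; move: (nsq (B x)) (nsq x) (nsq (x + _)) (complex.Re _) => b a s r.
nra.
Qed.

Lemma normc_sqr (a b r : R) : `|Complex a b| = r%:C%C -> a * a + b * b = r ^+ 2.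
Proof.
move=> ab; apply: (@complexI R); have := add_Re2_Im2 (Complex a b).
by rewrite ab /= !expr2 => ->; rewrite rmorphM.
Qed.

(* Without this bound the supremum defining [M_rho] could be the junk value 0. *)
Lemma M_rho_ubound (A : {linear H -> H}) (rho : R) :
  0 < rho ->
  (forall z : R[i], `|z| = rho%:C%C -> ~ in_spectrum ip A z) ->
  exists c : R, 0 <= c /\ forall (z : R[i]) (B : {linear H -> H}), `|z| = rho%:C%C ->
    is_resolvent ip A z B -> forall x, nsq (B x) <= c * nsq x.
Proof.
move=> rho0 spec.
(* Compactness is used on a square containing the circle. Off the circle [P] holds vacuously nearby;
   on it, [P] holds nearby for all large [c]. *)
pose P (c : R) (p : R * R) := `|Complex p.1 p.2| = rho%:C%C ->
  forall B : {linear H -> H}, is_resolvent ip A (Complex p.1 p.2) B ->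
  forall x, nsq (B x) <= c * nsq x.
have cpt : compact (`[- rho, rho] `*` `[- rho, rho] : set (R * R)).
  by apply: compact_setX; exact: segment_compact.
move/compact_near_coveringP : cpt => /(_ R (pinfty_nbhs R) P _) near_cov.
have [[a b] _|] := near_cov.
  have [ab|ab] := eqVneq (`|Complex a b|) rho%:C%C; last first.
    have cf : (fun p : R * R => p.1 * p.1 + p.2 * p.2 - rho ^+ 2) @ (a, b) -->
        a * a + b * b - rho ^+ 2.
      have c1 : (fun p : R * R => p.1) @ (a, b) --> a by exact: cvg_fst.
      have c2 : (fun p : R * R => p.2) @ (a, b) --> b by exact: cvg_snd.
      exact: (cvgB (cvgD (cvgM c1 c1) (cvgM c2 c2)) (cvg_cst _)).
    have nz : a * a + b * b - rho ^+ 2 != 0.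
      apply: contra ab => /eqP/subr0_eq ab; rewrite normc_def/= ab.
      by rewrite sqrtr_sqr gtr0_norm.
    have nearp := @cvgr_neq0 _ _ _ _ _ _ _ cf nz.
    exists ([set p : R * R | p.1 * p.1 + p.2 * p.2 - rho ^+ 2 != 0], setT) => /=.
      by split; [exact: nearp|exact: filterT].
    by move=> [[a' b'] c] [/= + _] ab'; rewrite (normc_sqr ab') subrr eqxx.
  have /contrapT[B0 [B0b [B0l _]]] := spec _ ab.
  have [C C0 B0C] := bounded_op_nsq B0b.
  (* Balls of [R * R] are for the max norm, so the squared distance is at most [2 * d ^+ 2], and
     [8 * C * d ^+ 2 <= 1]. *)
  pose d := (4 * (C + 1))^-1.
  have d0 : 0 < d by rewrite invr_gt0 mulr_gt0// ltr_wpDl.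
  have dC : 4 * d * C + 4 * d = 1 by rewrite /d; field; lra.
  exists (ball (a, b) d, [set c : R | 4 * C <= c]) => /=.
    by split; [exact: nbhsx_ballx|exact: nbhs_pinfty_ge (num_real _)].
  move=> [[a' b'] c] [[/= aa bb] cC] ab' B [_ [_ Br]] x.
  apply: (@le_trans _ _ (4 * C * nsq x)); last by rewrite ler_wpM2r ?nsq_ge0.
  apply: (resolvent_local_bound C0 B0C B0l Br).
  rewrite normc_def/= sqr_sqrtr ?addr_ge0 ?sqr_ge0//.
  move: aa bb; rewrite /ball/= !ltr_norml => /andP[a1 a2] /andP[b1 b2].
  have a3 : (a - a') ^+ 2 <= d ^+ 2 by nra.
  have b3 : (b - b') ^+ 2 <= d ^+ 2 by nra.
  nra.
move=> M [_ MP]; pose c := `|M| + 1.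
have Mc : M < c by rewrite (le_lt_trans (ler_norm M))// ltrDl.
exists c; split; first by rewrite addr_ge0.
move=> [a b] B z HB; apply: (MP c Mc (a, b)) => //.
have ab := normc_sqr z.
by split; rewrite /= in_itv/=; apply/andP; split; nra.
Qed.

(** With the uniform bound the supremum dominates [opnorm] of every resolvent on the circle; the
    point [z = rho] shows that it is nonnegative. *)
Lemma M_rho_bound (A : {linear H -> H}) (rho : R) :
  0 < rho ->
  (forall z : R[i], `|z| = rho%:C%C -> ~ in_spectrum ip A z) ->
  0 <= M_rho ip A rho /\ forall z : R[i], `|z| = rho%:C%C ->
    exists B : {linear H -> H}, is_resolvent ip A z B /\
      forall x, nsq (B x) <= M_rho ip A rho ^+ 2 * nsq x.
Proof.
move=> rho0 spec; have [c [c0 cP]] := M_rho_ubound rho0 spec.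
have opM (z : R[i]) (B : {linear H -> H}) : `|z| = rho%:C%C -> is_resolvent ip A z B ->
    opnorm ip B <= M_rho ip A rho.
  move=> zr BP; apply: ub_le_sup; last by exists z; split=> //; exists B.
  exists (Num.sqrt c) => _ [z' [zr' [B' [BP' ->]]]].
  by apply: opnorm_le => // x; rewrite sqr_sqrtr//; exact: cP BP' x.
have op0 (B : {linear H -> H}) : bounded_op ip B -> 0 <= opnorm ip B.
  move=> [k Bk]; apply: ub_le_sup.
    exists `|k| => _ [y /= y1 <-]; apply: (le_trans (Bk y)).
    apply: (le_trans (ler_wpM2r _ (ler_norm k))); first exact: hnorm_ge0.
    by rewrite ler_piMr.
  by exists 0; rewrite /= ?linear0 /Defs.hnorm (ip0l ipL) sqrtr0.
split=> [|z zr].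
  have rr : `|rho%:C%C| = rho%:C%C :> R[i] by rewrite ger0_norm// ler0c ltW.
  have /contrapT[B BP] := spec _ rr.
  by apply: le_trans (opM _ _ rr BP); apply: op0; case: BP.
have /contrapT[B BP] := spec _ zr; exists B; split=> // x.
have Bb := BP.1.
apply: (le_trans (nsq_opnorm x Bb)); rewrite ler_wpM2r ?nsq_ge0//.
have o := opM _ _ zr BP.
by rewrite ler_sqr ?nnegrE ?op0// (le_trans (op0 _ Bb) o).
Qed.
End Resolvent.

(** * Transfer to the weighted space *)

Section WeightedSpace.
Context (R : realType) (H : lmodType R[i]) (ip : H -> H -> R[i]).
Context (A : {linear H -> H}) (rho : R).
Hypothesis hilb : is_hilbert ip.
Hypothesis A_bounded : bounded_op ip A.
Hypothesis rho0 : 0 < rho.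
Hypothesis spec : forall z : R[i], `|z| = rho%:C%C -> ~ in_spectrum ip A z.
Let M := M_rho ip A rho.
Local Notation nsq := (nsq ip).

Let ipL (a : R[i]) x y z : ip (a *: x + y) z = a * ip x z + ip y z.
Proof. by case: hilb => -[]. Qed.
Let ipC x y : ip y x = conjc (ip x y).
Proof. by case: hilb => -[]. Qed.
Let ip_ge0 x : 0 <= ip x x.
Proof. by case: hilb. Qed.
Let ip_eq0 x : ip x x = 0 -> x = 0.
Proof. by case: hilb => _ _ + _ _; exact. Qed.

Let complete (u : nat -> H) :
  (forall e : R, 0 < e -> exists N : nat, forall m n : nat,
    (N <= m)%N -> (N <= n)%N -> nsq (u m - u n) <= e) ->
  exists l : H, forall e : R, 0 < e -> exists N : nat, forall n : nat,
    (N <= n)%N -> nsq (u n - l) <= e.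
Proof.
move=> cu; case: hilb => _ _ _ /(_ u) + _ => -[|l lP].
  (* Halving turns the non-strict bound on squares into the strict one on norms. *)
  move=> e e0; have [|N NP] := cu (e ^+ 2 / 2); first by rewrite divr_gt0 ?exprn_gt0.
  exists N => m n Nm Nn; rewrite (hnorm_lt ip_ge0 _ e0).
  by apply: (le_lt_trans (NP m n Nm Nn)); rewrite ltr_pdivrMr// ltr_pMr ?exprn_gt0// ltr1n.
exists l => e e0; have se : 0 < Num.sqrt e by rewrite sqrtr_gt0.
have [N NP] := lP _ se; exists N => n Nn; have := NP n Nn.
by rewrite (hnorm_lt ip_ge0 _ se) sqr_sqrtr ?(ltW e0)// => /ltW.
Qed.

Lemma M_rho_ge0 : 0 <= M.
Proof. by have [] := M_rho_bound ipL ipC ip_ge0 ip_eq0 rho0 spec. Qed.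

Let resolvent (s : R[i]) : `|s| = 1 -> exists B : {linear H -> H},
  [/\ forall x, B ((rho%:C%C * s) *: x - A x) = x,
      forall y, (rho%:C%C * s) *: B y - A (B y) = y &
      forall x, nsq (B x) <= M ^+ 2 * nsq x].
Proof.
move=> s1; have [_ /(_ (rho%:C%C * s))] := M_rho_bound ipL ipC ip_ge0 ip_eq0 rho0 spec.
case=> [|B [[_ [B1 B2]] B3]]; last by exists B.
by rewrite normrM s1 mulr1 ger0_norm// ler0c ltW.
Qed.

(** The isometry from the weighted space onto unweighted l2, which conjugates [tau - A] to
    [rho tau - A]. *)
Definition normalize (u : int -> H) (k : int) : H := (rho ^ (- k))%:C%C *: u k.

Lemma shift_op_normalize w k :
  shift_op A rho (normalize w) k = normalize (zsub (tau w) (compw A w)) k.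
Proof.
rewrite /shift_op /normalize [A (_ *: _)]linearZ/= scalerA -rmorphM/=.
rewrite (_ : rho * _ = rho ^ (- k)) -?scalerBr// opprD expfzDr ?gt_eqF//.
by rewrite mulrCA exprN1 mulfV ?mulr1 ?gt_eqF.
Qed.

Lemma l2w_sqE u : l2w_sq ip rho u = (\esum_(k in [set: int]) (nsq (normalize u k))%:E)%E.
Proof.
apply: eq_esum => k _; congr (_%:E).
rewrite /normalize (nsqZr ipL ipC ip_ge0) (hnorm_sqr ip_ge0) mulrC; congr (_ * _).
by rewrite exprnP exprz_exp; congr (_ ^ _); lia.
Qed.

Lemma l2w_sq_le u c : (l2w_sq ip rho u <= c%:E)%E <-> wbound (nsq \o normalize u) c.
Proof. by rewrite l2w_sqE; apply: esum_le_wbound => k; exact: nsq_ge0. Qed.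

Lemma l2w_sq_ge0 u : (0 <= l2w_sq ip rho u)%E.
Proof. by rewrite l2w_sqE; apply: esum_ge0 => k _; rewrite lee_fin nsq_ge0. Qed.

Lemma in_l2wP u : in_l2w ip rho u <-> exists d, wbound (nsq \o normalize u) d.
Proof.
split=> [ul|[d /l2w_sq_le ud]]; last exact: le_lt_trans ud (ltry _).
exists (fine (l2w_sq ip rho u)); apply/l2w_sq_le.
by rewrite fineK// ge0_fin_numE// l2w_sq_ge0.
Qed.

Lemma normw_wbound u : in_l2w ip rho u -> wbound (nsq \o normalize u) (normw ip rho u ^+ 2).
Proof.
move=> ul; apply/l2w_sq_le; rewrite /normw sqr_sqrtr ?fine_ge0 ?l2w_sq_ge0//.
by rewrite fineK// ge0_fin_numE// l2w_sq_ge0.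
Qed.

Lemma normw_le u c : 0 <= c -> wbound (nsq \o normalize u) (c ^+ 2) -> normw ip rho u <= c.
Proof.
move=> c0 uc; have /l2w_sq_le lc := uc.
rewrite /normw -(ger0_norm c0) -sqrtr_sqr ler_wsqrtr// -lee_fin fineK//.
by rewrite ge0_fin_numE ?l2w_sq_ge0// (le_lt_trans lc (ltry _)).
Qed.

Lemma normalizeB u v k : normalize (zsub u v) k = normalize u k - normalize v k.
Proof. by rewrite /normalize scalerBr. Qed.

Lemma in_l2wB u v : in_l2w ip rho u -> in_l2w ip rho v -> in_l2w ip rho (zsub u v).
Proof.
move=> /in_l2wP[d ud] /in_l2wP[c vc]; apply/in_l2wP.
exists (2 * d + 2 * c); apply: le_wbound (wboundB ipL ipC ip_ge0 ud vc) => // k.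
by rewrite /= normalizeB.
Qed.

Lemma shift_in_l2w u : in_l2w ip rho u -> in_l2w ip rho (zsub (tau u) (compw A u)).
Proof.
have [K K0 AK] := bounded_op_nsq ip_ge0 A_bounded.
move=> /in_l2wP[d ud]; apply/in_l2wP; eexists.
apply: le_wbound (wbound_shift_op ipL ipC ip_ge0 rho K0 AK ud) => // k.
by rewrite /= shift_op_normalize.
Qed.

Lemma shift_apriori w v c : in_l2w ip rho w -> zsub (tau w) (compw A w) = v ->
  wbound (nsq \o normalize v) c -> wbound (nsq \o normalize w) (M ^+ 2 * c).
Proof.
have [K K0 AK] := bounded_op_nsq ip_ge0 A_bounded.
move=> /in_l2wP[d wd] wv vc.
apply: (shift_op_apriori ipL ipC ip_ge0 K0 AK resolvent wd).
by apply: le_wbound vc => // k; rewrite /= shift_op_normalize wv.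
Qed.

Lemma shiftB w w' : zsub (tau (zsub w w')) (compw A (zsub w w')) =
  zsub (zsub (tau w) (compw A w)) (zsub (tau w') (compw A w')).
Proof.
by apply/funext => k; rewrite /zsub /tau /compw linearB/= !opprD opprK addrACA.
Qed.

(** Existence is surjectivity carried back through [normalize]; uniqueness is the a priori bound
    with right-hand side 0. *)
Lemma shift_bijective v : in_l2w ip rho v ->
  exists! w, in_l2w ip rho w /\ zsub (tau w) (compw A w) = v.
Proof.
have [K K0 AK] := bounded_op_nsq ip_ge0 A_bounded.
have rk (k : int) : (rho ^ k)%:C%C != 0 :> R[i].
  by rewrite fmorph_eq0 expfz_neq0// gt_eqF.
move=> /in_l2wP[d vd].
have [W [[d' Wd'] WT]] := shift_op_surjective ipL ipC ip_ge0 ip_eq0 K0 AK resolvent complete vd.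
pose w k := (rho ^ (- k))%:C%C^-1 *: W k.
have wW : normalize w = W by apply/funext => k; rewrite /normalize /w scalerA mulfV ?scale1r.
have wl : in_l2w ip rho w by apply/in_l2wP; exists d'; rewrite wW.
have wv : zsub (tau w) (compw A w) = v.
  apply/funext => k; apply: (scalerI (rk (- k))).
  by have := shift_op_normalize w k; rewrite wW WT => /esym.
exists w; split=> // w' [w'l w'v].
have z : zsub (tau (zsub w w')) (compw A (zsub w w')) = fun=> 0.
  by rewrite shiftB wv w'v; apply/funext => k; rewrite /zsub subrr.
have z0 : wbound (nsq \o normalize (fun=> 0)) 0.
  by move=> a n; rewrite /wsum big1// => i _; rewrite /= /normalize scaler0 (nsq0 ipL).
have := shift_apriori (in_l2wB wl w'l) z z0; rewrite mulr0 => w0.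
apply/funext => k; apply/eqP; rewrite -subr_eq0; apply/eqP.
apply: (scalerI (rk (- k))); rewrite scaler0; apply: (nsq_eq0 ip_ge0 ip_eq0).
by apply/eqP; rewrite eq_le (wbound_le k w0) nsq_ge0.
Qed.

(** * Truncation to nonnegative indices and the Lipschitz estimate *)

Lemma chi_wbound w c : wbound (nsq \o normalize w) c ->
  wbound (nsq \o normalize (chi_nonneg w)) c.
Proof.
apply: le_wbound => // k; rewrite /= /normalize /chi_nonneg.
by case: ifP => // _; rewrite scaler0 (nsq0 ipL) nsq_ge0.
Qed.

Lemma chiB (w1 w2 : int -> H) : zsub (chi_nonneg w1) (chi_nonneg w2) = chi_nonneg (zsub w1 w2).
Proof. by apply/funext => k; rewrite /zsub /chi_nonneg; case: ifP; rewrite ?subr0. Qed.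

(** The terms [delta_m1 x] cancel in the difference, so [w1 - w2] solves the equation with
    right-hand side [f1 - f2]; truncation does not increase the norm. *)
Lemma chi_shift_lipschitz w1 w2 f1 f2 x : in_l2w ip rho w1 -> in_l2w ip rho w2 ->
  in_l2w ip rho f1 -> in_l2w ip rho f2 ->
  zsub (tau w1) (compw A w1) = zadd f1 (delta_m1 x) ->
  zsub (tau w2) (compw A w2) = zadd f2 (delta_m1 x) ->
  normw ip rho (zsub (chi_nonneg w1) (chi_nonneg w2)) <= M * normw ip rho (zsub f1 f2).
Proof.
move=> w1l w2l f1l f2l E1 E2.
apply: normw_le; first by rewrite mulr_ge0 ?M_rho_ge0// sqrtr_ge0.
rewrite chiB exprMn; apply: chi_wbound.
apply: (shift_apriori (in_l2wB w1l w2l) _ (normw_wbound (in_l2wB f1l f2l))).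
rewrite shiftB E1 E2; apply/funext => k.
by rewrite /zsub /zadd opprD addrACA subrr addr0.
Qed.

End WeightedSpace.

Theorem theorem4p5 (R : realType) (H : lmodType R[i]) (ip : H -> H -> R[i])
    (A : {linear H -> H}) (rho : R) (F : (int -> H) -> (int -> H)) (LipF : R) :
  is_hilbert ip ->
  bounded_op ip A ->
  0 < rho ->
  (forall z : R[i], `|z| = (rho%:C)%C -> ~ in_spectrum ip A z) ->
  (forall u, in_l2w ip rho u -> in_l2w ip rho (F u)) ->
  0 <= LipF ->
  (forall u v, in_l2w ip rho u -> in_l2w ip rho v ->
     normw ip rho (zsub (F u) (F v)) <= LipF * normw ip rho (zsub u v)) ->
  LipF * M_rho ip A rho < 1 ->
  (* well-definedness: tau - A is invertible on l_{2,rho}(Z;H) ... *)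
  ((forall u, in_l2w ip rho u -> in_l2w ip rho (zsub (tau u) (compw A u))) /\
   (forall v, in_l2w ip rho v ->
      exists! w, in_l2w ip rho w /\ zsub (tau w) (compw A w) = v)) /\
  (* ... and L_rho(x,u) = chi (tau - A)^{-1}(F u + delta_{-1} x) lies in l_{2,rho} *)
  (forall (x : H) u w, in_l2w ip rho u -> in_l2w ip rho w ->
      zsub (tau w) (compw A w) = zadd (F u) (delta_m1 x) ->
      in_l2w ip rho (chi_nonneg w)) /\
  (* for every x, L_rho(x, .) is a contraction on l_{2,rho}(Z;H) *)
  (forall x : H, exists q : R, 0 <= q /\ q < 1 /\
     forall u1 u2 w1 w2, in_l2w ip rho u1 -> in_l2w ip rho u2 ->
       in_l2w ip rho w1 -> in_l2w ip rho w2 ->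
       zsub (tau w1) (compw A w1) = zadd (F u1) (delta_m1 x) ->
       zsub (tau w2) (compw A w2) = zadd (F u2) (delta_m1 x) ->
       normw ip rho (zsub (chi_nonneg w1) (chi_nonneg w2))
         <= q * normw ip rho (zsub u1 u2)).
Proof.
move=> hilb A_bounded rho0 spec F_l2w LipF0 F_lip contr.
have M0 := M_rho_ge0 hilb rho0 spec.
split.
  split=> [u|v]; first exact: (shift_in_l2w hilb A_bounded rho0).
  exact: (shift_bijective hilb A_bounded rho0 spec).
split=> [x u w _ wl _|x].
  have [d wd] := (in_l2wP hilb rho0 w).1 wl.
  by apply/(in_l2wP hilb rho0 _); exists d; exact: (chi_wbound hilb wd).
(* The same contraction constant serves every [x]. *)
exists (LipF * M_rho ip A rho); split; first by rewrite mulr_ge0.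
split=> // u1 u2 w1 w2 u1l u2l w1l w2l E1 E2.
apply: (le_trans (chi_shift_lipschitz hilb A_bounded rho0 spec w1l w2l
  (F_l2w _ u1l) (F_l2w _ u2l) E1 E2)).
by rewrite [LipF * _]mulrC -mulrA ler_wpM2l// F_lip.
Qed.
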